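(* For all $n \in \mathbb{Z}^+$ and all $h \in \mathbb{N}$ with $0 \leq h < n-1$, there exists a universal cycle for $\mathcal{W}(n,h)$.
   Context: $\mathcal{W}(n)$ denotes the set of weak orders on $[n]$ (transitive and complete relations), represented as words: $\mathcal{W}(n)$ is the set of all words $w_1w_2\ldots w_n$ of length $n$ over the nonnegative integers such that $\{w_1,\dots,w_n\} = \{0,1,\dots,h\}$ for some $h$ with $0 \le h \le n-1$ (here $w_j$ is the height of element $j$ in the weak order). This $h$, i.e. the maximum letter of $w$, is the height of $w$, and $\mathcal{W}(n,h)$ is the set of $w \in \mathcal{W}(n)$ of height $h$; that is, the set of words $w_1\ldots w_n$ with $\{w_1,\dots,w_n\}=\{0,1,\dots,h\}$. Here $\mathbb{N}$ includes $0$. Let $\mathcal{C}$ be a set of $N$ strings, each of length $m$. A universal cycle (ucycle) for $\mathcal{C}$ is a word $a_0a_1\ldots a_{N-1}$ such that each $c \in \mathcal{C}$ appears exactly once as a subword $a_{i+1}a_{i+2}\ldots a_{i+m}$ (one value of $i$ modulo $N$), where subscripts are taken modulo $N$. (In particular every such subword is a string in $\mathcal{C}$.) *)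

(* Defs.v *)
From mathcomp Require Import all_boot.
From mathcomp Require Import boolp classical_sets functions cardinality.

Set Implicit Arguments.
Unset Strict Implicit.
Unset Printing Implicit Defensive.

Local Open Scope classical_set_scope.
Local Open Scope card_scope.
Local Open Scope nat_scope.

(* The letter [tnth w j] is the height of the element [j] of [n] in the weak
   order coded by [w]. *)
Definition weak_orders (n : nat) : set (n.-tuple nat) :=
  [set w | exists2 h, h <= n - 1 & [set` w] = [set k | k <= h]].
Arguments weak_orders : clear implicits.

Definition height (n : nat) (w : n.-tuple nat) : nat := \max_(k <- w) k.

Definition weak_orders_of_height (n h : nat) : set (n.-tuple nat) :=
  [set w | weak_orders n w /\ height w = h].
Arguments weak_orders_of_height : clear implicits.

(* The subword [a_(i+1) ... a_(i+m)], with [j] counted from 0 and subscripts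
   read modulo [N]; [m] may exceed [N]. *)
Definition cyclic_subword (m N : nat) (a : N.-tuple nat) (i : nat) :
    m.-tuple nat :=
  [tuple nth 0 a ((i + j.+1) %% N) | j < m].

(* The second conjunct follows from the other two by counting. *)
Definition universal_cycle (m N : nat) (C : set (m.-tuple nat))
    (a : N.-tuple nat) : Prop :=
  [/\ C #= `I_N,
      forall i : 'I_N, C (cyclic_subword m a i)
    & forall c, C c -> exists! i : 'I_N, cyclic_subword m a i = c].

(* Main.v *)
(** The words of [W(n,h)] are the edges of the de Bruijn-type graph on words of
    length [n - 1], and a universal cycle is an Eulerian circuit. Encode a
    decomposition of the edges into circuits as a permutation [s] sending each
    edge to a consecutive one, and take [s] with the fewest cycles. Composing
    [s] with the transposition of two edges that end at the same vertex merges
    their cycles, so such edges already share a cycle of [s]. Hence the cycle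
    of a word is stable under rotation and under changing the first letter, and
    therefore under changing any one letter. Since [h + 1 < n], every surjective
    word has a repeated letter, and this spare position lets one pass from any
    word to any other by changing one letter at a time: [s] is one cycle. *)

Require Import Defs.
From mathcomp Require Import all_boot all_fingroup.
From mathcomp Require Import boolp classical_sets functions cardinality.

Set Implicit Arguments.
Unset Strict Implicit.
Unset Printing Implicit Defensive.

Local Open Scope nat_scope.

(** * Merging the cycles of a permutation *)

Lemma perm_mem_porbit (T : finType) (s : {perm T}) (x : T) : s x \in porbit s x.
Proof. by have := mem_porbit s 1 x; rewrite expg1. Qed.

Lemma porbit_trans (T : finType) (s : {perm T}) (y x z : T) :
  x \in porbit s y -> y \in porbit s z -> x \in porbit s z.
Proof. by rewrite -!eq_porbit_mem => /eqP ->. Qed.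

Lemma merged_circuits (T : finType) (V : eqType) (src tgt : T -> V)
    (r : {perm T}) : (forall x, src (r x) = tgt x) ->
  exists s : {perm T}, [/\ forall x, src (s x) = tgt x,
    forall x y, tgt x = tgt y -> x \in porbit s y
    & forall x, r x \in porbit s x].
Proof.
move=> rP; pose P (s : {perm T}) := [forall x, src (s x) == tgt x].
have Pr : P r by apply/forallP => x; rewrite rP.
case: (arg_minnP (fun s : {perm T} => #|porbits s|) Pr) => s /forallP Ps mins.
have tgt_orbit x y : tgt x = tgt y -> x \in porbit s y.
  move=> xy; apply: contraT => nxy.
  have := porbits_mul_tperm s x y; rewrite nxy /=.
  have /mins : P (tperm x y * s)%g.
    apply/forallP => z; rewrite permM (eqP (Ps _)).
    by case: tpermP => // ->; rewrite xy.
  (* With [p] the number of cycles of [s], minimality and the cycle count give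
     [p + 2 <= p + (x != y)], while a boolean is at most 1. *)
  move: #|porbits s| => p le_p eq_p.
  by move: le_p; rewrite -(leq_add2r 2) eq_p leq_add2l; case: (x != y).
exists s; split=> // [x|x]; first exact/eqP.
(* The predecessor of [r x] under [s] ends at the same vertex as [x], hence lies in the cycle of
   [x]. *)
have src_r : src (s (s^-1%g (r x))) = tgt x by rewrite permKV rP.
rewrite -{1}(permKV s (r x)).
apply: porbit_trans (perm_mem_porbit _ _) (tgt_orbit _ _ _).
by rewrite -src_r (eqP (Ps _)).
Qed.

(** * Connecting surjective words by changes of one letter *)

Section SurjectiveWords.

Variables I K : finType.

Definition surj_word := {w : {ffun I -> K} | [forall c, c \in codom w]}.

Definition one_change (x y : surj_word) : bool :=
  [exists i, forall j, (j != i) ==> (val x j == val y j)].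

Definition distance (x y : surj_word) : nat := #|[set i | val x i != val y i]|.

Lemma surj_word_onto (x : surj_word) (c : K) : exists i, val x i = c.
Proof.
by have /forallP/(_ c)/codomP[i ->] := valP x; exists i.
Qed.

Lemma connect_one_change_sym (x y : surj_word) :
  connect one_change x y = connect one_change y x.
Proof.
apply: sym_connect_sym => {}x {}y; rewrite /one_change.
by under eq_existsb do under eq_forallb do rewrite [val x _ == _]eq_sym.
Qed.

(** The old letter at [i] survives at [j], so overwriting position [i] keeps the word surjective. *)
Lemma change_repeated_letter (x : surj_word) (i j : I) (c : K) :
  i != j -> val x i = val x j ->
  exists2 y : surj_word, connect one_change x y
    & forall l, val y l = if l == i then c else val x l.
Proof.
move=> ij xij; pose w := [ffun l => if l == i then c else val x l].
have Pw : [forall d, d \in codom w].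
  apply/forallP => d; have [l <-] := surj_word_onto x d.
  apply/codomP; have [->|li] := eqVneq l i.
    by exists j; rewrite ffunE eq_sym (negPf ij).
  by exists l; rewrite ffunE (negPf li).
exists (Sub w Pw) => [|l]; last by rewrite SubK ffunE.
apply: connect1; apply/existsP; exists i; apply/forallP => l.
by apply/implyP => li; rewrite SubK ffunE (negPf li).
Qed.

Lemma correct_repeated_letter (x y : surj_word) (i j : I) :
  val x i != val y i -> i != j -> val x i = val x j ->
  exists2 z, connect one_change x z & distance z y < distance x y.
Proof.
move=> xyi ij xij; have [z xz zE] := change_repeated_letter (val y i) ij xij.
exists z => //; apply: proper_card; apply/properP; split.
  by apply/fintype.subsetP => l; rewrite !inE zE; case: (eqVneq l i) => // ->; rewrite eqxx.
by exists i; rewrite !inE ?zE ?eqxx.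
Qed.

(** Let [x] and [y] differ at [i], and let [x] carry the letter [val y i] at [j]. If [y] repeats
    that letter at [j], then [y] itself can be corrected at [i]. Otherwise [x] moves, using a
    repeated letter that the pigeonhole principle provides. Allowing either end to move is harmless,
    as connection is symmetric. *)
Lemma reduce_distance (x y : surj_word) : #|K| < #|I| -> x != y ->
  (exists2 z, connect one_change x z & distance z y < distance x y) \/
  (exists2 z, connect one_change y z & distance z x < distance y x).
Proof.
move=> ltKI xy.
have [i xyi] : exists i, val x i != val y i.
  apply/existsP; apply: contraR xy; rewrite negb_exists => /forallP eqxy.
  by apply/eqP/val_inj/ffunP => i; apply/eqP; rewrite -[_ == _]negbK eqxy.
have [j xj] := surj_word_onto x (val y i).
have ij : i != j by apply/eqP => ij; case/eqP: xyi; rewrite -xj ij.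
have [yij|yij] := eqVneq (val y i) (val y j).
  by right; apply: correct_repeated_letter ij yij; rewrite eq_sym.
have /injectivePn[a [b ab xab]] : ~~ injectiveb (val x).
  apply/negP => /injectiveP/leq_card; rewrite leqNgt ltKI; exact/negP.
left.
have [xya|xya] := eqVneq (val x a) (val y a); last first.
  exact: correct_repeated_letter xya ab xab.
have xyj : val x j != val y j by rewrite xj.
have [ja ia] : j != a /\ i != a.
  by split; [apply: contraNneq xyj|apply: contraNneq xyi] => ->; apply/eqP.
(* The repeated letter at [a] makes room for [val x i], which frees position
   [i] for the letter [val y i], which in turn frees position [j]. *)
have [u xu uE] := change_repeated_letter (val x i) ab xab.
have [||v uv vE] := @change_repeated_letter u i a (val y i) => //.
  by rewrite !uE eqxx (negPf ia).
have [||z vz zE] := @change_repeated_letter v j i (val y j) => //.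
- by rewrite eq_sym.
- by rewrite !vE uE eqxx eq_sym (negPf ij) (negPf ja) xj.
exists z; first exact: connect_trans (connect_trans xu uv) vz.
rewrite /distance; set D := [set l | val x l != val y l].
rewrite (cardsD1 i D) (cardsD1 j (D :\ i)) !inE xyi xyj eq_sym ij /= !add1n ltnS.
(* Positions [i] and [j] have become correct and only [a] may have been spoiled, a net gain of at
   least one. *)
have sub : [set l | val z l != val y l] \subset a |: (D :\ i :\ j).
  apply/fintype.subsetP => l; rewrite !inE zE vE uE.
  case: (eqVneq l j) => [->|lj]; first by rewrite eqxx.
  case: (eqVneq l i) => [->|li]; first by rewrite eqxx.
  by case: (eqVneq l a).
apply: leq_trans (subset_leq_card sub) _.
by rewrite cardsU1; case: (_ \notin _).
Qed.

Lemma surj_word_connected (x y : surj_word) :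
  #|K| < #|I| -> connect one_change x y.
Proof.
move=> ltKI; have distC u v : distance u v = distance v u.
  by apply: eq_card => i; rewrite !inE eq_sym.
have [d] := ubnP (distance x y); elim: d x y => // d IHd x y; rewrite ltnS => le.
have [->|/(reduce_distance ltKI)] := eqVneq x y; first exact: connect0.
case=> -[z conn lt].
  apply: connect_trans conn _; exact: IHd (leq_trans lt le).
rewrite connect_one_change_sym; apply: connect_trans conn _.
by apply: IHd; apply: leq_trans lt _; rewrite distC.
Qed.

End SurjectiveWords.

(** * The de Bruijn-type graph and its Eulerian circuit *)

Section Rotation.

Variables (m : nat) (K : finType).

Local Notation word := (surj_word 'I_m.+1 K).

(** Endpoints of the edge [x]: [lift ord_max] skips the last position, giving the prefix of length
    [m]; [lift ord0] below skips the first, giving the suffix. *)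
Definition word_src (x : word) : {ffun 'I_m -> K} :=
  [ffun i => val x (lift ord_max i)].

Definition word_tgt (x : word) : {ffun 'I_m -> K} :=
  [ffun i => val x (lift ord0 i)].

Lemma rotation_subproof (x : word) :
  [forall c, c \in codom [ffun i => val x (ordS i)]].
Proof.
apply/forallP => c; have [i <-] := surj_word_onto x c.
by apply/codomP; exists (ord_pred i); rewrite ffunE ord_predK.
Qed.

Definition rotation_fun (x : word) : word :=
  Sub [ffun i => val x (ordS i)] (rotation_subproof x).

Lemma rotation_fun_inj : injective rotation_fun.
Proof.
move=> x y /(congr1 val) /ffunP xy; apply: val_inj; apply/ffunP => i.
by have := xy (ord_pred i); rewrite !SubK !ffunE ord_predK.
Qed.

Definition rotation : {perm word} := perm rotation_fun_inj.

Lemma rotationE (x : word) (i : 'I_m.+1) : val (rotation x) i = val x (ordS i).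
Proof. by rewrite permE SubK ffunE. Qed.

Lemma iter_rotationE k (x : word) (i : 'I_m.+1) :
  val (iter k rotation x) i = val x (iter k (@ordS _) i).
Proof. by elim: k i => //= k IHk i; rewrite rotationE IHk -iterSr. Qed.

Lemma iter_ordS0 (i : 'I_m.+1) : iter i (@ordS _) ord0 = i.
Proof.
suff modE k : nat_of_ord (iter k (@ordS m.+1) ord0) = k %% m.+1.
  by apply: val_inj; rewrite /= modE modn_small.
by elim: k => [|k IHk] /=; rewrite ?mod0n // IHk -addn1 modnDml addn1.
Qed.

Lemma iter_ordS_inj k : injective (iter k (@ordS m.+1)).
Proof. by elim: k => // k IHk i j /ordS_inj/IHk. Qed.

Lemma ordS_lift (i : 'I_m) : ordS (lift ord_max i) = lift ord0 i.
Proof. by apply: val_inj; rewrite /= /bump leqNgt ltn_ord add0n modn_small ?ltnS. Qed.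

(** This makes [rotation] an admissible initial decomposition into circuits for
    [merged_circuits]. *)
Lemma rotation_src (x : word) : word_src (rotation x) = word_tgt x.
Proof. by apply/ffunP => i; rewrite !ffunE rotationE ordS_lift. Qed.

Lemma word_circuit : #|K| < m.+1 ->
  exists s : {perm word}, (forall x, word_src (s x) = word_tgt x) /\
    forall x y, x \in porbit s y.
Proof.
move=> ltKm; have [s [src_s tgt_s rot_s]] := merged_circuits rotation_src.
exists s; split=> // x y.
have iter_rot k z : iter k rotation z \in porbit s z.
  elim: k => [|k IHk]; first exact: porbit_id.
  exact: porbit_trans (rot_s _) IHk.
have step u v : one_change u v -> u \in porbit s v.
  case/existsP => i /forallP uv.
  (* Rotating [i] times brings the changed position to the front, which the target ignores, so the
     two rotated words end at the same vertex. *)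
  apply: (porbit_trans (y := iter i rotation u)).
    by rewrite porbit_sym.
  apply: porbit_trans (iter_rot i v); apply: tgt_s.
  apply/ffunP => l; rewrite !ffunE !iter_rotationE.
  apply/eqP; apply: implyP (uv _) _; rewrite -[X in _ != X]iter_ordS0.
  by rewrite (inj_eq (@iter_ordS_inj _)) eq_sym neq_lift.
have /connectP[p] : connect (@one_change _ _) x y.
  by apply: surj_word_connected; rewrite card_ord.
elim: p x => [|z p IHp] x /=; first by move=> _ ->; exact: porbit_id.
by case/andP => /step xz /IHp zy /zy; exact: porbit_trans.
Qed.

End Rotation.

Local Open Scope classical_set_scope.

(** * From surjective words to tuples of natural numbers *)

Section Tuples.

Variables m h : nat.

Local Notation word := (surj_word 'I_m.+1 'I_h.+1).

Definition tuple_of_word (x : word) : m.+1.-tuple nat :=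
  [tuple nat_of_ord (val x j) | j < m.+1].

Lemma tuple_of_word_inj : injective tuple_of_word.
Proof.
move=> x y xy; apply: val_inj; apply/ffunP => j; apply: val_inj.
by have := congr1 (fun t => tnth t j) xy; rewrite !tnth_mktuple.
Qed.

Lemma height_initial (k : nat) (w : m.+1.-tuple nat) :
  [set` w] = [set i | i <= k] -> height w = k.
Proof.
move=> wE; have wP i : (i \in (w : seq nat)) = (i <= k).
  by apply/idP/idP => iw; [have : [set` w] i by []|have : [set j | j <= k] i by []];
    rewrite ?wE // -wE.
apply/eqP; rewrite eqn_leq; apply/andP; split.
  by apply/bigmax_leqP_seq => i; rewrite wP.
by apply: leq_bigmax_seq => //; rewrite wP.
Qed.

Lemma weak_orders_of_heightE : h <= m ->
  weak_orders_of_height m.+1 h = range tuple_of_word.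
Proof.
move=> hm; apply/seteqP; split=> w.
  case=> -[k _ wE] hw; move: (wE); rewrite -(height_initial wE) hw => {}wE.
  have wP i : (i \in (w : seq nat)) <-> i <= h.
    by have := congr1 (@^~ i) wE => /= ->.
  pose f := [ffun j => inord (tnth w j) : 'I_h.+1].
  have fE j : f j = tnth w j :> nat.
    by rewrite ffunE inordK // ltnS; apply/wP; exact: mem_tnth.
  have Pf : [forall c, c \in codom f].
    apply/forallP => c; have /wP/tnthP[j cE] : c <= h by rewrite -ltnS.
    by apply/codomP; exists j; apply: val_inj; rewrite /= fE.
  exists (Sub f Pf) => //; apply: eq_from_tnth => j.
  by rewrite tnth_mktuple SubK fE.
case=> x _ <-.
have wE : [set` tuple_of_word x] = [set k | k <= h].
  apply/seteqP; split=> k /=.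
    by case/mapP => j _ ->; rewrite -ltnS.
  rewrite -ltnS => kh; have [j xj] := surj_word_onto x (Ordinal kh).
  apply/mapP; exists j; first by rewrite mem_enum.
  by rewrite xj.
by split; [exists h; rewrite // subn1|exact: height_initial].
Qed.

End Tuples.

(** * Reading the universal cycle off the circuit *)

Lemma universal_cycle_bij (n N : nat) (C : set (n.-tuple nat)) (a : N.-tuple nat) :
  set_bij `I_N C (cyclic_subword n a) -> universal_cycle C a.
Proof.
case=> funC injC surjC; split.
- have -> : C = cyclic_subword n a @` `I_N.
    by apply/seteqP; split=> // c [i iN <-]; exact: funC.
  exact: inj_card_eq.
- by move=> i; apply: funC => /=.
- move=> c /surjC[i iN ci]; exists (Ordinal iN); split=> // j cj.
  by apply: val_inj; apply: injC; rewrite ?inE //= ci cj.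
Qed.

Theorem corollary3p8 (n h : nat) (n_gt0 : (0 < n)%N) (h_lt : (h < n - 1)%N) :
  exists (N : nat) (a : N.-tuple nat),
    universal_cycle (weak_orders_of_height n h) a.
Proof.
case: n n_gt0 h_lt => // m _; rewrite subn1 /= => hm.
have [|s [src_s orbit_s]] := @word_circuit m 'I_h.+1; first by rewrite card_ord.
(* Any starting word would do; this one is 0, 1, ..., h followed by zeros, since [inord] defaults to
   0 beyond [h]. *)
have Px0 : [forall c, c \in codom [ffun i : 'I_m.+1 => inord i : 'I_h.+1]].
  apply/forallP => c; apply/codomP; exists (inord c).
  by rewrite ffunE inordK ?inord_val // (leq_trans (ltn_ord c)) // ltnW.
pose x0 : surj_word 'I_m.+1 'I_h.+1 := Sub [ffun i : 'I_m.+1 => inord i] Px0.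
pose N := #|porbit s x0|; pose x i := iter i s x0.
have N_gt0 : 0 < N by rewrite lt0n card_porbit_neq0.
have x_mod i : x (i %% N) = x i.
  rewrite /x {2}(divn_eq i N) addnC iterD; congr iter.
  by elim: (i %/ N) => //= k IHk; rewrite mulSn iterD -IHk iter_porbit.
(* Each step along the circuit shifts the word one place to the left, so the first letters along the
   circuit determine all the others. *)
have letter i k (lt_k : k < m.+1) :
    val (x i) (Ordinal lt_k) = val (x (i + k)) ord0.
  elim: k i lt_k => [|k IHk] i lt_k.
    by rewrite addn0; congr (fun_of_fin _ _); apply: val_inj.
  rewrite addnS -addSn -(IHk i.+1 (ltnW lt_k)); pose k' := Ordinal (lt_k : k < m).
  have -> : Ordinal lt_k = lift ord0 k' by apply: val_inj.
  have -> : Ordinal (ltnW lt_k) = lift ord_max k'.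
    by apply: val_inj; rewrite [RHS]lift_max.
  by have /ffunP/(_ k') := src_s (x i); rewrite !ffunE.
pose a := [tuple nat_of_ord (val (x i) ord0) | i < N].
(* The subword of index [i] starts at the letter of index [i + 1], whence [x i.+1]. *)
have subwordE i : cyclic_subword m.+1 a i = tuple_of_word (x i.+1).
  apply: eq_from_tnth => -[j lt_j]; rewrite !tnth_mktuple letter addSnnS [nat_of_ord (Ordinal _)]/=.
  have lt_mod : (i + j.+1) %% N < N by rewrite ltn_mod.
  by rewrite -[_ %% N]/(nat_of_ord (Ordinal lt_mod)) -tnth_nth tnth_mktuple x_mod.
exists N, a; apply: universal_cycle_bij; rewrite weak_orders_of_heightE 1?ltnW //.
split=> [i _|i j /[!inE] iN jN|_ [y _ <-]] /=.
- by rewrite subwordE; exists (x i.+1).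
- rewrite !subwordE => /tuple_of_word_inj /perm_inj xij.
  apply/eqP; rewrite -(nth_uniq x0 _ _ (uniq_traject_porbit s x0)) ?size_traject //.
  by rewrite !nth_traject //; apply/eqP.
(* Because of this shift by one, the index of [y] is the place of its predecessor on the circuit. *)
- have := orbit_s (s^-1%g y) x0; rewrite porbit_traject => /trajectP[i iN yE].
  by exists i => //; rewrite subwordE /x /= -yE permKV.
Qed.
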